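(* Let $F\ge 1$ be an integer, let $f=80F$ and $\rho=1/4$. Let $(\mathtt{C}_M)_{M\ge 1}$ be a family of binary codes as described in the context for this $\rho$. Let $s$ be an integer with $f+1\le s\le 3f+1$, let $M$ be the smallest positive integer with $k_M\ge s$, and let $\mathtt{r}\in\{0,1\}^s$ be any string (thought of as one bit per node of a group $(v_1,\dots,v_s)$ ordered by increasing IDs). Let $\mathtt{w}=\mathtt{C}_M(\mathtt{r}\circ 0^{k_M-s})\in\{0,1\}^{N_M}$, and split $\mathtt{w}$ into $s$ consecutive blocks $(\mathtt{w}_1,\dots,\mathtt{w}_s)$, each of size $\lceil |\mathtt{w}|/s\rceil$ or $\lfloor |\mathtt{w}|/s\rfloor$. Then (1) $\lceil |\mathtt{w}|/s\rceil\le 80$, and (2) the string $\mathtt{r}$ is uniquely determined (decodable) from $(\mathtt{w}_1,\dots,\mathtt{w}_s)$ when up to $F$ of the blocks $\mathtt{w}_i$ are erased (with the positions of the erased blocks known).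
   Context: A binary code $\mathtt{C}:\{0,1\}^k\to\{0,1\}^N$ maps $k$-bit strings to $N$-bit codewords; its rate is $k/N$, and its relative distance $\delta$ means that any two distinct codewords differ in at least $\delta N$ positions, so that any pattern of at most $\delta N-1$ erased positions can be corrected. $H(x)=x\log(1/x)+(1-x)\log(1/(1-x))$ is the binary entropy function. For a given rate $\rho<1/2$, the family $(\mathtt{C}_M)_{M\ge1}$ consists of binary codes $\mathtt{C}_M:\{0,1\}^{k_M}\to\{0,1\}^{N_M}$ with $N_M=2M(2^M-1)$, $k_M=\rho_M N_M$ where $\rho_M\ge\rho$, and relative distance $\delta_M>(1-2\rho)H^{-1}(1/2)$ (such codes exist by Justesen's construction). $a\circ b$ denotes concatenation and $0^m$ the all-zero string of length $m$. *)

(* Defs.v *)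
From HB Require Import structures.
From mathcomp Require Import all_boot all_order all_algebra.
From mathcomp Require Import all_classical all_reals all_analysis.

Set Implicit Arguments.
Unset Strict Implicit.
Unset Printing Implicit Defensive.

Import Order.TTheory GRing.Theory Num.Theory.

Local Open Scope ring_scope.

Definition log2 {R : realType} (x : R) : R := ln x / ln 2.

(* At x = 0 and x = 1 the conventions 0^-1 = 0 and ln 0 = 0 give the usual
   value 0. *)
Definition binary_entropy {R : realType} (x : R) : R :=
  x * log2 x^-1 + (1 - x) * log2 (1 - x)^-1.

(* The inverse of the entropy function on [0, 1/2], where it is a strictly
   increasing bijection onto [0, 1]; the value outside [0, 1] is irrelevant. *)
Definition binary_entropy_inv {R : realType} (y : R) : R :=
  xget 0 [set x : R | 0 <= x <= 2^-1 /\ binary_entropy x = y]%classic.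

Definition hamming_dist {n : nat} (x y : n.-tuple bool) : nat :=
  #|[set i : 'I_n | tnth x i != tnth y i]|.

Definition has_relative_distance {R : realType} {k N : nat}
    (C : k.-tuple bool -> N.-tuple bool) (delta : R) : Prop :=
  forall x y, C x != C y -> delta * N%:R <= (hamming_dist (C x) (C y))%:R.

Definition codelen (M : nat) : nat := (2 * M * (2 ^ M - 1))%N.

(* The encoding maps are required to be injective, since distances are measured
   between distinct codewords.  Nothing is assumed about the index 0. *)
Record is_code_family {R : realType} (rho : R) (k : nat -> nat)
    (C : forall M, (k M).-tuple bool -> (codelen M).-tuple bool)
    (rhoM deltaM : nat -> R) : Prop := IsCodeFamily {
  code_inj : forall M, (1 <= M)%N -> injective (C M);
  code_dim : forall M, (1 <= M)%N -> (k M)%:R = rhoM M * (codelen M)%:R;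
  code_rate : forall M, (1 <= M)%N -> rho <= rhoM M;
  code_dist : forall M, (1 <= M)%N -> has_relative_distance (C M) (deltaM M);
  code_delta : forall M, (1 <= M)%N ->
    (1 - 2 * rho) * binary_entropy_inv 2^-1 < deltaM M
}.

Definition pad0 {s k : nat} (hsk : (s <= k)%N) (r : s.-tuple bool) :
    k.-tuple bool :=
  tcast (subnKC hsk) [tuple of r ++ nseq (k - s) false].

Definition ceil_divn (m d : nat) : nat := ((m + d.-1) %/ d)%N.

(* A way of cutting a string of length N into s consecutive blocks is given by
   the tuple sh of block sizes. *)
Definition balanced_split (N s : nat) (sh : s.-tuple nat) : Prop :=
  sumn sh = N /\
  forall i, tnth sh i = ceil_divn N s \/ tnth sh i = (N %/ s)%N.

Definition blocks {s : nat} (sh : s.-tuple nat) (w : seq bool) :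
    s.-tuple (seq bool) :=
  [tuple nth [::] (reshape sh w) i | i < s].

(* An erased block is replaced by None, so the erased positions are visible to
   the decoder. *)
Definition erase {T : Type} {s : nat} (E : {set 'I_s}) (b : s.-tuple T) :
    s.-tuple (option T) :=
  [tuple if i \in E then None else Some (tnth b i) | i < s].

(* Main.v *)
Require Import Defs.
From HB Require Import structures.
From mathcomp Require Import all_boot all_order all_algebra.
From mathcomp Require Import all_classical all_reals all_analysis.
From mathcomp Require Import zify ring lra.

(** Injectivity gives [k M <= codelen M], so [s >= 81] forces [M >= 4]; there
    the code lengths grow by a factor of at most 3, and [k (M - 1) < s] with rate
    1/4 gives [codelen M <= 12 s].  Since [80 F < s <= codelen M], erasing [F]
    blocks loses fewer than [codelen M / 40] positions.  On the other hand the
    entropy is below 1/2 on [0, 1/20], hence the relative distance exceeds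
    [1/2 * 1/20 = 1/40], and two codewords cannot agree on all remaining
    blocks. *)

Set Implicit Arguments.
Unset Strict Implicit.
Unset Printing Implicit Defensive.

Import Order.TTheory GRing.Theory Num.Theory.
Import numFieldNormedType.Exports.

Local Open Scope ring_scope.

Section Entropy.
Variable R : realType.
Implicit Types x : R.

Lemma ln_le_subr1 x : 0 < x -> ln x <= x - 1.
Proof.
move=> x0; have := @le_ln1Dx R (x - 1).
by rewrite subrKC; apply; lra.
Qed.

Lemma ln2_ge_half : 2^-1 <= ln 2 :> R.
Proof.
have := @ln_le_subr1 2^-1; rewrite lnV ?posrE; last by lra.
by move=> /(_ ltac:(lra)); lra.
Qed.

Lemma binary_entropyE x : 0 < x < 1 ->
  binary_entropy x = (- (x * ln x) - (1 - x) * ln (1 - x)) / ln 2.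
Proof.
by move=> /andP[x0 x1]; rewrite /binary_entropy /log2 !lnV ?posrE; lra.
Qed.

(* Tangent bounds for [ln]: at 1 for [(1 - x)^-1], and at 16 for [x^-1]. *)
Lemma binary_entropy_lt_half x : 0 <= x <= 20^-1 -> binary_entropy x < 2^-1.
Proof.
have l2 := ln2_ge_half.
move=> /andP[]; rewrite le_eqVlt => /predU1P[<- _|x0 x1].
  by rewrite /binary_entropy /log2 invr0 subr0 invr1 ln1 mul0r; lra.
rewrite binary_entropyE; last by lra.
rewrite ltr_pdivrMr; last by lra.
have h1 : - ((1 - x) * ln (1 - x)) <= x.
  have /ln_le_subr1 : 0 < (1 - x)^-1 by rewrite invr_gt0; lra.
  rewrite lnV ?posrE; last by lra.
  have y0 : 0 < 1 - x by lra.
  rewrite -(ler_pM2l y0) mulrN mulrBr divff; lra.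
have h2 : - (x * ln x) <= 16^-1 + x * (ln 2 *+ 4 - 1).
  have /ln_le_subr1 : 0 < (x * 2 ^+ 4)^-1 by rewrite invr_gt0; lra.
  rewrite lnV ?posrE; last by lra.
  rewrite lnM ?posrE; [|lra|lra].
  rewrite lnXn; last by lra.
  rewrite -(ler_pM2l x0) mulrN mulrBr invfM mulrA divff; last by lra.
  by rewrite -natrX /=; lra.
(* In the sum of [h1] and [h2] the bare [x] cancels, leaving 1/16 + 4 x ln 2 <= 1/16 + (ln 2)/5.
   This is below (ln 2)/2 because ln 2 >= 1/2. *)
have : x * ln 2 <= 20^-1 * ln 2 by rewrite ler_pM2r //; lra.
lra.
Qed.

Lemma binary_entropy_half : binary_entropy 2^-1 = 1 :> R.
Proof.
have l2 := ln2_ge_half.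
rewrite binary_entropyE; last by lra.
rewrite (_ : 1 - 2^-1 = 2^-1 :> R); last by lra.
by rewrite lnV ?posrE; [field; lra | lra].
Qed.

Lemma continuous_binary_entropy x : 0 < x < 1 ->
  {for x, continuous (@binary_entropy R)}.
Proof.
move=> /andP[x0 x1].
have cV (y : R) : 0 < y -> {for y, continuous (fun z : R => log2 z^-1)}.
  move=> y0; apply: cvgMl.
  apply: (@continuous_comp _ _ _ (@GRing.inv R) (@ln R)).
    by apply: inv_continuous; lra.
  by apply: continuous_ln; rewrite invr_gt0.
have cB : {for x, continuous (fun z : R => 1 - z)}.
  by apply: cvgB; [exact: cvg_cst | exact: cvg_id].
apply: cvgD; apply: cvgM.
- exact: cvg_id.
- exact: cV.
- exact: cB.
- apply: (@continuous_comp _ _ _ (fun z : R => 1 - z) (fun z : R => log2 z^-1)).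
    exact: cB.
  by apply: cV; lra.
Qed.

Lemma binary_entropy_inv_half_gt : 20^-1 < binary_entropy_inv 2^-1 :> R.
Proof.
rewrite /binary_entropy_inv; set S := [set _ | _]%classic.
(* The entropy goes from below 1/2 at 1/20 to 1 at 1/2, so a preimage of 1/2 exists and [xget] does
   not fall back on its default 0. *)
have [/andP[x0 x1] Hx] : S (xget 0 S).
  apply: xgetPex.
  have [|||c] := @IVT R (@binary_entropy R) 20^-1 2^-1 2^-1.
  - lra.
  - apply: continuous_in_subspaceT => x; rewrite inE /= in_itv /= => ?.
    by apply: continuous_binary_entropy; lra.
  - have := @binary_entropy_lt_half 20^-1 ltac:(lra).
    rewrite binary_entropy_half ge_min le_max => /ltW ->; lra.
  - by rewrite in_itv /= => /andP[? ?] ?; exists c; split => //; lra.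
rewrite ltNge; apply/negP => xle.
by have := @binary_entropy_lt_half (xget 0 S) ltac:(lra); rewrite Hx ltxx.
Qed.

End Entropy.

(** With P = 2^m this reads (m+1)(2P-1) <= 3m(P-1). It holds from m = 3 on, but fails at m = 2,
    where 42 > 36. *)
Lemma codelenS_le m : (3 <= m)%N -> (codelen m.+1 <= 3 * codelen m)%N.
Proof.
move=> m3; rewrite /codelen expnS.
have : (2 ^ 3 <= 2 ^ m)%N by rewrite leq_exp2l.
by move: (2 ^ m)%N => P; nia.
Qed.

Lemma injective_tuple_bool_leq k N (C : k.-tuple bool -> N.-tuple bool) :
  injective C -> (k <= N)%N.
Proof. by move=> /leq_card; rewrite !card_tuple card_bool leq_exp2l. Qed.

Lemma pad0_inj s k (hsk : (s <= k)%N) : injective (pad0 hsk).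
Proof.
move=> r r' /(congr1 (@tval _ _)); rewrite /pad0 !val_tcast /= => /eqP.
by rewrite eqseq_cat ?size_tuple // => /andP[/eqP/val_inj].
Qed.

Lemma ceil_divn_mul_lt m d : (0 < d)%N -> (ceil_divn m d * d < m + d)%N.
Proof. by move=> d0; have := leq_trunc_div (m + d.-1) d; rewrite /ceil_divn; lia. Qed.

Lemma ceil_divn_le m d c : (0 < d)%N -> (m <= c * d)%N -> (ceil_divn m d <= c)%N.
Proof. by move=> d0 mc; rewrite -ltnS /ceil_divn ltn_divLR //; lia. Qed.

Lemma balanced_split_le N s (sh : s.-tuple nat) i : (0 < s)%N ->
  balanced_split N sh -> (tnth sh i <= ceil_divn N s)%N.
Proof. by move=> s0 [_ /(_ i)[] -> //]; apply: leq_div2r; lia. Qed.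

(** Outside [E] the left side shows [Some], so the right side must show the same [Some], whatever
    [E'] is. *)
Lemma erase_eq_tnth T s (E E' : {set 'I_s}) (b b' : s.-tuple T) :
  erase E b = erase E' b' ->
  forall i, i \notin E -> tnth b i = tnth b' i.
Proof.
move=> e i /negbTE iE; have := congr1 (fun t => tnth t i) e.
by rewrite !tnth_mktuple iE; case: (i \in E') => // -[].
Qed.

(* The positions where [w] and [w'] differ inject into [E] times offsets. *)
Lemma hamming_dist_blocks N s (sh : s.-tuple nat) c (E : {set 'I_s})
    (w w' : N.-tuple bool) :
  sumn sh = N -> (forall i, tnth sh i <= c)%N ->
  (forall i, i \notin E -> tnth (blocks sh w) i = tnth (blocks sh w') i) ->
  (hamming_dist w w' <= #|E| * c)%N.
Proof.
move=> shN shc eqE; rewrite /hamming_dist.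
set D := [set _ | _]%SET.
pose pos (i : 'I_N) := (reshape_index sh i, reshape_offset sh i).
rewrite cardE -(size_map pos) cardE -(size_map val) -[c in X in (_ <= X)%N](size_iota 0).
rewrite -(size_allpairs pair); apply: uniq_leq_size.
  rewrite map_inj_uniq ?enum_uniq // => i j [ei eo]; apply: val_inj.
  by rewrite /= -(reshape_indexK sh i) ei eo reshape_indexK.
move=> p /mapP[i]; rewrite mem_enum inE => neq ->{p}.
have ish : (i < sumn sh)%N by rewrite shN.
have := reshape_indexP ish; rewrite size_tuple => ri.
apply: allpairs_f; last first.
  rewrite mem_iota add0n /=; apply: leq_trans (reshape_offsetP ish) _.
  by have := shc (Ordinal ri); rewrite (tnth_nth 0%N).
apply/mapP; exists (Ordinal ri) => //; rewrite mem_enum.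
(* By contraposition: if the block holding position [i] is not in [E], both words have the same
   block there, hence the same bit at [i]. *)
apply: contraNT neq => /eqE; rewrite !tnth_mktuple /= => eqb.
have nthE (v : N.-tuple bool) : tnth v i =
    nth false (nth [::] (reshape sh v) (reshape_index sh i)) (reshape_offset sh i).
  have := nth_flatten false (reshape sh v) i.
  by rewrite reshapeKr ?reshapeKl ?size_tuple ?shN //= -tnth_nth.
by rewrite !nthE eqb.
Qed.

Theorem theorem3 (R : realType) (F f : nat) (rho : R)
    (hF : (1 <= F)%N) (hf : f = (80 * F)%N) (hrho : rho = 1 / 4)
    (k : nat -> nat)
    (C : forall M : nat, (k M).-tuple bool -> (codelen M).-tuple bool)
    (rhoM deltaM : nat -> R)
    (hC : is_code_family rho C rhoM deltaM)
    (s : nat) (hs : (f + 1 <= s <= 3 * f + 1)%N)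
    (M : nat) (hM : (1 <= M)%N) (hsM : (s <= k M)%N)
    (hMmin : forall M' : nat, (1 <= M')%N -> (s <= k M')%N -> (M <= M')%N) :
  (forall r : s.-tuple bool,
     (ceil_divn (size (C M (pad0 hsM r))) s <= 80)%N) /\
  (forall sh : s.-tuple nat, balanced_split (codelen M) sh ->
     exists decode : s.-tuple (option (seq bool)) -> s.-tuple bool,
       forall (r : s.-tuple bool) (E : {set 'I_s}), (#|E| <= F)%N ->
         decode (erase E (blocks sh (C M (pad0 hsM r)))) = r).
Proof.
case: hC => Cinj Cdim Crate Cdist Cdelta.
have kN := injective_tuple_bool_leq (Cinj M hM).
have s0 : (0 < s)%N by lia.
split=> [r|sh shB].
  rewrite size_tuple; apply: ceil_divn_le => //.
  (* The code lengths at 1, 2, 3 are 2, 12, 42, all below 81. *)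
  have M4 : (4 <= M)%N.
    move: hM kN hsM; case: (M) => [|[|[|[|m]]]] // _; rewrite /codelen; lia.
  have M1 : (1 <= M.-1)%N by lia.
  have kM1 : (k M.-1 < s)%N.
    by rewrite ltnNge; apply/negP => /(hMmin _ M1); lia.
  have N4k : (codelen M.-1 <= 4 * k M.-1)%N.
    rewrite -(ler_nat R) natrM Cdim //.
    have := Crate _ M1; rewrite hrho => rM.
    have N0 : 0 <= (codelen M.-1)%:R :> R by [].
    have := ler_wpM2r N0 rM; lra.
  have := @codelenS_le M.-1; rewrite prednK //; lia.
pose sent r y := exists2 E : {set 'I_s},
  (#|E| <= F)%N & erase E (blocks sh (C M (pad0 hsM r))) = y.
exists (fun y => xget [tuple of nseq s false] [set r | sent r y]%classic) => r E EF.
set y := erase _ _.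
have [E' EF' ey] : sent (xget [tuple of nseq s false] [set r | sent r y]%classic) y.
  by apply: (@xgetPex _ _ [set r | sent r y]%classic); exists r, E.
move: (xget _ _) ey => r' ey.
apply: (@pad0_inj _ _ hsM); apply: (Cinj M hM); apply/eqP/negPn/negP => neq.
have := Cdist M hM _ _ neq.
have := hamming_dist_blocks (proj1 shB)
  (fun i => balanced_split_le i s0 shB) (erase_eq_tnth ey).
have := ceil_divn_mul_lt (codelen M) s0.
move: (hamming_dist _ _) (ceil_divn _ _) => d c cs dE.
(* With N = [codelen M], 80 F c <= s c < N + s <= 2 N: since s <= N, rounding the block size up
   costs at most a factor 2. *)
have dN : (40 * d < codelen M)%N.
  have : (d <= F * c)%N by apply: leq_trans dE _; rewrite leq_mul2r EF' orbT.
  nia.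
have dlt : 40^-1 < deltaM M.
  have := binary_entropy_inv_half_gt R; have := Cdelta M hM; rewrite hrho; lra.
have N0 : 0 < (codelen M)%:R :> R by rewrite ltr0n; lia.
have := dlt; rewrite -(ltr_pM2r N0).
move: dN; rewrite -(ltr_nat R) natrM; lra.
Qed.
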